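(* Let $h\ge 1$ be an integer, let $\varphi(x_1,\ldots,x_h)=\sum_{i=1}^h c_i x_i$ be a linear form with integer coefficients $c_1,\ldots,c_h$ that satisfies condition $N$, let $C=\sum_{i=1}^h |c_i|$, and let $B=\{b_1<b_2<\cdots\}$ be an infinite set of integers. Suppose that for some real number $m\ge 0$ one has $b_1>m$ and $b_{k+1}>C b_k+(C+1)m$ for all positive integers $k$. Then there exist a $\varphi$-Sidon set $A=\{a_1,a_2,\ldots\}$ of integers and a constant $m_0>0$ such that $|a_k-b_k|<m_0$ for all positive integers $k$.
   Context: Condition $N$: for $I\subseteq\{1,\ldots,h\}$ put $s_I=\sum_{i\in I}c_i$, with $s_\emptyset=0$. The linear form $\varphi=\sum_{i=1}^h c_ix_i$ satisfies condition $N$ if there do not exist disjoint subsets $I_1,I_2$ of $\{1,\ldots,h\}$, not both empty, with $s_{I_1}=s_{I_2}$. $\varphi$-Sidon set: a nonempty set $A$ of integers is a $\varphi$-Sidon set if for all $h$-tuples $(a_1,\ldots,a_h)\in A^h$ and $(a_1',\ldots,a_h')\in A^h$, $\varphi(a_1,\ldots,a_h)=\varphi(a_1',\ldots,a_h')$ implies $(a_1,\ldots,a_h)=(a_1',\ldots,a_h')$. The notation $A=\{a_1,a_2,\ldots\}$ denotes an enumeration of an infinite set by pairwise distinct elements. *)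

(* Defs.v *)
From mathcomp Require Import all_boot all_order all_algebra.
From mathcomp Require Import all_classical all_reals.

Set Implicit Arguments.
Unset Strict Implicit.
Unset Printing Implicit Defensive.

Import Order.TTheory GRing.Theory Num.Theory.

Local Open Scope ring_scope.

Definition linear_form (h : nat) (c : 'I_h -> int) (x : 'I_h -> int) : int :=
  \sum_(i < h) c i * x i.

Definition subset_sum (h : nat) (c : 'I_h -> int) (I : {set 'I_h}) : int :=
  \sum_(i in I) c i.

(* [finset.set0] is the empty finite set; the unqualified [set0] is the one of
   classical_sets. *)
Definition condition_N (h : nat) (c : 'I_h -> int) : Prop :=
  ~ exists I1 I2 : {set 'I_h},
      [/\ [disjoint I1 & I2],
          ~ (I1 = finset.set0 /\ I2 = finset.set0)
        & subset_sum c I1 = subset_sum c I2].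

Definition phi_Sidon (h : nat) (c : 'I_h -> int) (A : set int) : Prop :=
  nonempty A /\
  forall x y : 'I_h -> int,
    (forall i, A (x i)) -> (forall i, A (y i)) ->
    linear_form c x = linear_form c y -> x =1 y.

(* Sequences are indexed from 0, so [a k] is the (k+1)-st listed element. *)
Definition enumerates (a : nat -> int) (A : set int) : Prop :=
  injective a /\ A = range a.

Definition enumerates_increasingly (b : nat -> int) (B : set int) : Prop :=
  {homo b : i j / (i < j)%N >-> i < j} /\ B = range b.

(* Main.v *)
(** The set [B] itself is a phi-Sidon set, so [a = b] works.  Suppose
    [phi x = phi y] with [x <> y], and let [b_K] be the largest element of [B]
    occurring at a coordinate where [x] and [y] differ.  With [I] (resp. [J])
    the coordinates where only [x] (resp. only [y]) equals [b_K], condition N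
    gives [|s_I - s_J| >= 1], while the remaining part of [phi x - phi y] is a
    combination of differences of two numbers in [[0, b_(K-1)]], hence at most
    [C b_(K-1) < b_K] in absolute value. *)
Require Import Defs.
From mathcomp Require Import all_boot all_order all_algebra.
From mathcomp Require Import all_classical all_reals.
From mathcomp Require Import lra.

Import Order.TTheory GRing.Theory Num.Theory.

Local Open Scope ring_scope.

Lemma phi_Sidon_range (h : nat) (c : 'I_h -> int) (b : nat -> int) :
  condition_N c ->
  {homo b : i j / (i < j)%N >-> i < j} ->
  0 < b 0%N ->
  (forall k, (\sum_(i < h) `|c i|) * b k < b k.+1) ->
  phi_Sidon c (range b).
Proof.
move=> cN bS b0 bC; split; first by exists (b 0%N), 0%N.
have bW : {homo b : i j / (i <= j)%N >-> i <= j} := ltW_homo bS.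
have bpos k : 0 < b k by apply: (lt_le_trans b0); exact: bW.
move=> x y xB yB xy.
have /choice[p px] : forall i, exists k, b k = x i.
  by move=> i; have [k _ <-] := xB i; exists k.
have /choice[q qy] : forall i, exists k, b k = y i.
  by move=> i; have [k _ <-] := yB i; exists k.
suff pq i : p i = q i by move=> i; rewrite -px -qy pq.
apply/eqP/negPn/negP => pqi.
(* The maximum is over a nonempty set, since it contains [i], so it is attained at some [j]. *)
pose K := (\max_(j | p j != q j) maxn (p j) (q j))%N.
have leK j : p j != q j -> (p j <= K)%N && (q j <= K)%N.
  by move=> pqj; rewrite -geq_max /K (bigD1 j)//= leq_maxl.
have [j pqj Kj] : exists2 j, p j != q j & K = maxn (p j) (q j).
  by rewrite /K (bigop.bigmax_eq_arg i)//; case: arg_maxnP => // j pqj _; exists j.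
(* [M] bounds every value of index below [K]. With the default 0 at [K = 0], [CM] reduces there to
   [0 < b 0] and [leM] is vacuous. *)
pose M : int := if K is k.+1 then b k else 0.
have CM : (\sum_(i < h) `|c i|) * M < b K.
  by rewrite /M; case: K {leK Kj M} => [|k]; rewrite ?mulr0.
have leM k : (k < K)%N -> b k <= M.
  by rewrite /M; case: K {leK Kj M CM} => // k'; rewrite ltnS; exact: bW.
have M0 : 0 <= M by rewrite /M; case: K {leK Kj M CM leM} => // k; exact: ltW.
pose I := [set i | (p i == K) && (q i != K)]%SET.
pose J := [set i | (q i == K) && (p i != K)]%SET.
(* What is left of [x i - y i] once the uncancelled copies of [b K] are removed. *)
pose w i := x i - y i - b K * ((i \in I)%:R - (i \in J)%:R).
have wM l : `|w l| <= M.
  rewrite /w /I /J !inE -px -qy.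
  have := bpos (p l); have := bpos (q l).
  (* [w l] is 0 if the indices agree, plus or minus the smaller value if exactly one index is [K],
     and otherwise a difference of two values in [[0, M]]. *)
  case: (eqVneq (p l) (q l)) => [->|pql].
    by case: (q l == K); rewrite /= ?subrr ?mulr0 ?subr0 normr0.
  have /andP[] := leK _ pql; rewrite leq_eqVlt => /predU1P[pK|pK];
    rewrite leq_eqVlt => /predU1P[qK|qK].
  - by rewrite pK qK eqxx in pql.
  - have := leM _ qK; rewrite pK eqxx (ltn_eqF qK) /= ler_norml; lra.
  - have := leM _ pK; rewrite qK eqxx (ltn_eqF pK) /= ler_norml; lra.
  - have := leM _ pK; have := leM _ qK.
    rewrite (ltn_eqF qK) (ltn_eqF pK) /= ler_norml; lra.
have sIJ : subset_sum c I != subset_sum c J.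
  apply/eqP => IJ; apply: cN; exists I, J; split => //.
    rewrite -finset.setI_eq0; apply/eqP/finset.setP => l; rewrite !inE.
    by case: (p l == K); case: (q l == K).
  (* The coordinate [j] attaining [K] lies in [I] or in [J]. *)
  move=> [/finset.setP/(_ j) + /finset.setP/(_ j)]; rewrite !inE Kj.
  by case: leqP => _; rewrite eqxx ?pqj // eq_sym pqj.
have sumE (S : {set 'I_h}) :
    subset_sum c S = \sum_(i < h) c i * (i \in S)%:R.
  rewrite /subset_sum big_mkcond; apply: eq_bigr => l _.
  by case: ifP; rewrite ?mulr1 ?mulr0.
have wE : b K * (subset_sum c J - subset_sum c I) = \sum_(i < h) c i * w i.
  have : linear_form c x - linear_form c y = 0 by rewrite xy subrr.
  rewrite /linear_form -sumrB => xy0.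
  rewrite -[LHS]add0r -[X in X + _]xy0 !sumE -sumrB mulr_sumr -big_split /=.
  by apply: eq_bigr => l _; rewrite /w; lra.
have : b K <= (\sum_(i < h) `|c i|) * M.
  (* A nonzero integer has absolute value at least 1. *)
  apply: (@le_trans _ _ `|b K * (subset_sum c J - subset_sum c I)|).
    rewrite normrM (gtr0_norm (bpos K)) ler_pMr//.
    by rewrite -gtz0_ge1 normr_gt0 subr_eq0 eq_sym.
  rewrite wE mulr_suml; apply: (le_trans (ler_norm_sum _ _ _)).
  by apply: ler_sum => l _; rewrite normrM ler_wpM2l.
by rewrite leNgt CM.
Qed.

Theorem theorem1p3 (R : realType) (h : nat) (h_ge1 : (1 <= h)%N)
    (c : 'I_h -> int) (cN : condition_N c)
    (B : set int) (B_inf : infinite_set B)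
    (b : nat -> int) (b_enum : enumerates_increasingly b B)
    (m : R) (m_ge0 : 0 <= m)
    (b_first : m < (b 0%N)%:~R)
    (b_growth : let C : int := \sum_(i < h) `|c i| in
       forall k : nat,
         C%:~R * (b k)%:~R + (C%:~R + 1) * m < (b k.+1)%:~R) :
  exists (A : set int) (a : nat -> int) (m0 : R),
    [/\ phi_Sidon c A,
        enumerates a A,
        0 < m0
      & forall k : nat, `|(a k)%:~R - (b k)%:~R| < m0].
Proof.
have [bS BE] := b_enum.
exists B, b, 1; split => //; last by move=> k; rewrite subrr normr0.
- rewrite BE; apply: phi_Sidon_range => //.
    by rewrite -(ltr0z R); exact: le_lt_trans b_first.
  (* The term [(C + 1) * m] is nonnegative, so dropping it leaves the integer inequality
     [C * b k < b k.+1]. *)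
  move=> k; rewrite -(ltr_int R) intrM; apply: le_lt_trans (b_growth k).
  rewrite lerDl mulr_ge0// addr_ge0// ler0z.
  by apply: sumr_ge0 => i _; exact: normr_ge0.
- by split=> //; exact: (inc_inj (le_mono bS)).
Qed.
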